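(* Let $Y$ be any sequence space, and suppose that the entries of the infinite matrices $A=(a_{nk})_{n,k\in\mathbb{N}}$ and $F=(f_{nk})_{n,k\in\mathbb{N}}$ of complex numbers are connected by the relation $$f_{nk}=\frac{a_{nk}}{n+1}-\frac{1}{n(n+1)}\sum_{j=0}^{n-1}a_{jk}\quad(n\ge 1),\qquad f_{0k}=a_{0k},$$ for all $k\in\mathbb{N}$. Then $A\in(Y:bv(C))$ if and only if $F\in(Y:\ell_1)$.
   Context: $\mathbb{N}=\{0,1,2,\ldots\}$ and $\omega=\mathbb{C}^{\mathbb{N}}$ is the space of all complex sequences; a sequence space is a linear subspace of $\omega$. $\ell_1$ is the space of absolutely summable complex sequences. The space of sequences of bounded variation is $bv=\{x\in\omega:\sum_{k=1}^{\infty}|x_k-x_{k-1}|<\infty\}$. The space $bv(C)$ is the matrix domain in $bv$ of the Cesàro matrix of order one: $bv(C)=\{x=(x_k)\in\omega:(\frac{1}{k+1}\sum_{j=0}^{k}x_j)_{k\in\mathbb{N}}\in bv\}$. For sequence spaces $X,Z$ and an infinite complex matrix $A=(a_{nk})$, $A\in(X:Z)$ means that for every $x\in X$ the series $(Ax)_n=\sum_{k=0}^{\infty}a_{nk}x_k$ converges for each $n\in\mathbb{N}$ and the sequence $Ax=((Ax)_n)_{n\in\mathbb{N}}$ belongs to $Z$. *)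

(* Defs.v *)
From Stdlib Require Import Reals.
From Coquelicot Require Import Coquelicot.
Open Scope C_scope.

Definition cseq := nat -> C.

Record sequence_space (Y : cseq -> Prop) : Prop := {
  sequence_space_zero : Y (fun _ => 0);
  sequence_space_plus : forall x y, Y x -> Y y -> Y (fun k => x k + y k);
  sequence_space_scal : forall (c : C) x, Y x -> Y (fun k => c * x k)
}.

Definition l1 (x : cseq) : Prop := ex_series (fun k => Cmod (x k)).

(* The sum over k >= 1 of |x_k - x_(k-1)|, reindexed to start at 0. *)
Definition bv (x : cseq) : Prop := ex_series (fun k => Cmod (x (S k) - x k)).

(* [sum_n x k] is x_0 + ... + x_k, with k + 1 terms. *)
Definition cesaro (x : cseq) : cseq := fun k => / INR (k + 1) * sum_n x k.

Definition bvC (x : cseq) : Prop := bv (cesaro x).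

(* The entry a_nk is [A n k]. *)
Definition cmatrix := nat -> nat -> C.

(* [is_series] asserts convergence, so this says that every series (A x)_n
   converges and that its sum is [y n]; such a [y] is unique. *)
Definition is_transform (A : cmatrix) (x y : cseq) : Prop :=
  forall n : nat, is_series (fun k => A n k * x k) (y n).

Definition matrix_class (X Z : cseq -> Prop) (A : cmatrix) : Prop :=
  forall x, X x -> exists y, is_transform A x y /\ Z y.

(* Main.v *)
Require Import Defs.
From Stdlib Require Import Reals Lia.
From Coquelicot Require Import Coquelicot.
Open Scope C_scope.

(** The n-th row of F is the difference of the n-th and (n-1)-st rows of the
    Cesàro means of A, and this operation is inverted by
    a_n = (n+1) (f_0 + ... + f_n) - n (f_0 + ... + f_(n-1)).  Both directions
    are finite linear combinations of rows, so A x exists exactly when F x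
    does, and F x is then the difference sequence of the Cesàro means of A x. *)

(** The mean preceding index 0 counts as 0, so partial sums telescope to [cesaro y] with no leftover
    term. *)
Definition cesaro_diff (y : cseq) : cseq := fun n =>
  match n with
  | O => y 0%nat
  | S m => cesaro y (S m) - cesaro y m
  end.

(* At [n = 0] the junk value [sum_n z (0 - 1) = z 0] has coefficient 0. *)
Definition cesaro_undiff (z : cseq) : cseq := fun n =>
  INR (n + 1) * sum_n z n - INR n * sum_n z (n - 1).

(* [sum_n] has its values in the carrier of a canonical structure, where [ring]
   and [field] do not recognize [C]. *)
Ltac at_C :=
  repeat match goal with
  | |- context [@sum_n ?G ?y ?n] =>
      let s := fresh "s" in set (s := @sum_n G y n); change C in (type of s);
      clearbody s
  end;
  match goal with |- @eq _ ?a ?b => change (@eq C a b) end.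
Ltac C_ring := at_C; ring.
Ltac C_field := at_C; field.

Lemma RtoC_INR_neq_0 (n : nat) : n <> 0%nat -> RtoC (INR n) <> 0.
Proof.
  intros Hn H. apply RtoC_inj in H. now apply (not_0_INR n).
Qed.

Lemma RtoC_INR_S (n : nat) : RtoC (INR (S n)) = INR n + 1.
Proof. now rewrite S_INR, RtoC_plus. Qed.

Lemma sum_n_C_S (y : cseq) (n : nat) : sum_n y (S n) = sum_n y n + y (S n).
Proof. exact (sum_Sn y n). Qed.

Lemma sum_n_cesaro (y : cseq) (n : nat) : sum_n y n = INR (n + 1) * cesaro y n.
Proof.
  unfold cesaro. C_field. apply RtoC_INR_neq_0. lia.
Qed.

Lemma cesaro_0 (y : cseq) : cesaro y 0%nat = y 0%nat.
Proof.
  unfold cesaro. rewrite sum_O. simpl. C_field.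
Qed.

Lemma sum_n_cesaro_diff (y : cseq) (n : nat) :
  sum_n (cesaro_diff y) n = cesaro y n.
Proof.
  induction n as [|n IH].
  - rewrite sum_O. now rewrite cesaro_0.
  - rewrite sum_n_C_S, IH. simpl. C_ring.
Qed.

Lemma cesaro_diffK (y : cseq) (n : nat) : cesaro_undiff (cesaro_diff y) n = y n.
Proof.
  unfold cesaro_undiff. rewrite !sum_n_cesaro_diff, <- sum_n_cesaro.
  destruct n as [|n].
  - rewrite sum_O. simpl. C_ring.
  - replace (S n - 1)%nat with n by lia.
    (* The occurrence rewritten is the weight of [cesaro y n]; their product then folds into
       [sum_n y n]. *)
    replace (S n) with (n + 1)%nat at 2 by lia.
    rewrite <- sum_n_cesaro, sum_n_C_S. C_ring.
Qed.

(** The terms of [cesaro_undiff z] are successive differences of (n+1) [sum_n z n], so their sum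
    telescopes and the mean cancels the factor n+1. *)
Lemma cesaro_cesaro_undiff (z : cseq) (n : nat) :
  cesaro (cesaro_undiff z) n = sum_n z n.
Proof.
  assert (H : sum_n (cesaro_undiff z) n = INR (n + 1) * sum_n z n).
  { induction n as [|n IH].
    - rewrite sum_O. unfold cesaro_undiff. simpl. C_ring.
    - rewrite sum_n_C_S, IH. unfold cesaro_undiff.
      replace (S n - 1)%nat with n by lia.
      replace (n + 1)%nat with (S n) by lia. C_ring. }
  unfold cesaro. rewrite H. C_field. apply RtoC_INR_neq_0. lia.
Qed.

(** The coefficient of the earlier terms is 1/(n+1) - 1/n = -1/(n(n+1)), which gives the formula
    defining [F]. *)
Lemma cesaro_diff_entry (y : cseq) (n : nat) : (1 <= n)%nat ->
  cesaro_diff y n =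
    y n / INR (n + 1) - / (INR n * INR (n + 1)) * sum_n y (n - 1).
Proof.
  destruct n as [|n]; intros Hn; [lia|].
  simpl cesaro_diff. unfold cesaro. rewrite sum_n_C_S.
  replace (S n - 1)%nat with n by lia.
  replace (n + 1)%nat with (S n) by lia.
  replace (S n + 1)%nat with (S (S n)) by lia.
  assert (H1 : RtoC (INR (S n)) <> 0) by (apply RtoC_INR_neq_0; lia).
  assert (H2 : RtoC (INR (S (S n))) <> 0) by (apply RtoC_INR_neq_0; lia).
  rewrite (RtoC_INR_S (S n)) in *.
  C_field. now split.
Qed.

(** The two series differ only by the term at index 0, which does not affect convergence. *)
Lemma bvC_cesaro_diff (y : cseq) : bvC y <-> l1 (cesaro_diff y).
Proof.
  symmetry. exact (ex_series_incr_1 (fun k => Cmod (cesaro_diff y k))).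
Qed.

Lemma l1_ext (x y : cseq) : (forall n, x n = y n) -> l1 x -> l1 y.
Proof.
  intros H. apply ex_series_ext. intros n. now rewrite H.
Qed.

Lemma cesaro_undiffK (z : cseq) (n : nat) : cesaro_diff (cesaro_undiff z) n = z n.
Proof.
  destruct n as [|n].
  - simpl. now rewrite <- cesaro_0, cesaro_cesaro_undiff, sum_O.
  - simpl. rewrite !cesaro_cesaro_undiff, sum_n_C_S. C_ring.
Qed.

(** The only analytic input: every row operation below reduces to combinations of two convergent
    series. *)
Lemma is_series_lincomb (a b x : cseq) (c d la lb : C) :
  is_series (fun k => a k * x k) la -> is_series (fun k => b k * x k) lb ->
  is_series (fun k => (c * a k + d * b k) * x k) (c * la + d * lb).
Proof.
  intros Ha Hb.
  apply is_series_ext with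
    (fun k => plus (scal c (a k * x k)) (scal d (b k * x k))).
  - intros k. change (c * (a k * x k) + d * (b k * x k) = (c * a k + d * b k) * x k).
    C_ring.
  - exact (is_series_plus _ _ _ _ (is_series_scal c _ _ Ha) (is_series_scal d _ _ Hb)).
Qed.

Lemma is_transform_ext (B B' : cmatrix) (x y : cseq) :
  (forall n k, B n k = B' n k) -> is_transform B x y -> is_transform B' x y.
Proof.
  intros H HB n. apply is_series_ext with (2 := HB n). intros k. now rewrite H.
Qed.

Section RowOperations.

Variables (B : cmatrix) (x y : cseq).
Hypothesis HB : is_transform B x y.

Lemma is_transform_sum_n :
  is_transform (fun n k => sum_n (fun j => B j k) n) x (sum_n y).
Proof.
  intros n. induction n as [|n IH].
  - rewrite sum_O. apply is_series_ext with (2 := HB 0%nat).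
    intros k. now rewrite sum_O.
  - replace (sum_n y (S n)) with (1 * sum_n y n + 1 * y (S n))
      by (rewrite sum_n_C_S; C_ring).
    apply is_series_ext with (2 := is_series_lincomb _ _ _ 1 1 _ _ IH (HB (S n))).
    intros k. rewrite sum_n_C_S. C_ring.
Qed.

Lemma is_transform_cesaro_diff :
  is_transform (fun n k => cesaro_diff (fun j => B j k) n) x (cesaro_diff y).
Proof.
  intros [|n]; [exact (HB 0%nat)|].
  (* Each Cesàro mean is a multiple of a partial sum, so two partial-sum rows suffice. *)
  replace (cesaro_diff y (S n))
    with (/ INR (S n + 1) * sum_n y (S n) + - / INR (n + 1) * sum_n y n)
    by (simpl cesaro_diff; unfold cesaro; C_ring).
  apply is_series_ext with (2 := is_series_lincomb _ _ _ _ _ _ _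
    (is_transform_sum_n (S n)) (is_transform_sum_n n)).
  intros k. simpl cesaro_diff. unfold cesaro. C_ring.
Qed.

Lemma is_transform_cesaro_undiff :
  is_transform (fun n k => cesaro_undiff (fun j => B j k) n) x (cesaro_undiff y).
Proof.
  intros n.
  replace (cesaro_undiff y n)
    with (INR (n + 1) * sum_n y n + - INR n * sum_n y (n - 1))
    by (unfold cesaro_undiff; C_ring).
  apply is_series_ext with (2 := is_series_lincomb _ _ _ _ _ _ _
    (is_transform_sum_n n) (is_transform_sum_n (n - 1)%nat)).
  intros k. unfold cesaro_undiff. C_ring.
Qed.

End RowOperations.

Lemma cesaro_undiff_ext (z z' : cseq) (n : nat) :
  (forall j, z j = z' j) -> cesaro_undiff z n = cesaro_undiff z' n.
Proof.
  intros H. unfold cesaro_undiff. now rewrite !(sum_n_ext z z' _ H).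
Qed.

Theorem theorem3p6 (Y : cseq -> Prop) (hY : sequence_space Y) (A F : cmatrix)
  (hF : forall n k : nat, (1 <= n)%nat ->
     F n k = A n k / INR (n + 1)
             - / (INR n * INR (n + 1)) * sum_n (fun j => A j k) (n - 1))
  (hF0 : forall k : nat, F 0%nat k = A 0%nat k) :
  matrix_class Y bvC A <-> matrix_class Y l1 F.
Proof.
  assert (HFA : forall n k, cesaro_diff (fun j => A j k) n = F n k).
  { intros [|n] k; [now rewrite hF0|].
    rewrite hF, cesaro_diff_entry by lia. reflexivity. }
  assert (HAF : forall n k, cesaro_undiff (fun j => F j k) n = A n k).
  { intros n k. rewrite <- (cesaro_diffK (fun j => A j k) n).
    apply cesaro_undiff_ext. intros j. now rewrite HFA. }
  split; intros H x Hx; destruct (H x Hx) as [y [Hy Hb]].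
  - exists (cesaro_diff y). split.
    + exact (is_transform_ext _ _ _ _ HFA (is_transform_cesaro_diff _ _ _ Hy)).
    + now apply bvC_cesaro_diff.
  (* Here [y] is F x, and the inverse operation turns it into A x, whose Cesàro differences are
     again [y]. *)
  - exists (cesaro_undiff y). split.
    + exact (is_transform_ext _ _ _ _ HAF (is_transform_cesaro_undiff _ _ _ Hy)).
    + apply bvC_cesaro_diff. apply l1_ext with (2 := Hb).
      intros n. now rewrite cesaro_undiffK.
Qed.
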